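(* Let $0\leq m_r\leq d_r$, $0\leq m_f\leq d_f$ satisfy $d_r\geq d_f-m_f$ and $d_f\geq d_r-m_r$. The following are equivalent: (i) $Sol_{BDC}^{m_r,d_r,m_f,d_f}$ is deterministic, i.e. $Sol_{BDC}^{m_r,d_r,m_f,d_f}(u)$ has exactly one element for every $u\in S$; (ii) $d_r=d_f-m_f$ and $d_f=d_r-m_r$; (iii) $m_r=m_f=0$; (iv) there exists $d\geq0$ such that for every $u\in S$, $Sol_{BDC}^{m_r,d_r,m_f,d_f}(u)=\{x\}$ where $x(t)=u(t-d)$ for all $t\in\mathbb{R}$.
   Context: $\mathbf{B}=\{0,1\}$ with Boolean operations, ordered by $0<1$. $S$ is the set of signals: functions $x:\mathbb{R}\to\mathbf{B}$ for which there is a strictly increasing unbounded sequence $t_0<t_1<t_2<\dots$ of reals such that $x$ is constant on $(-\infty,t_0)$ and on each $[t_k,t_{k+1})$. For a bounded interval $I$ and $u\in S$, $\bigcap_{\xi\in I}u(\xi)$ equals $1$ iff $u(\xi)=1$ for all $\xi\in I$, and $\bigcup_{\xi\in I}u(\xi)$ equals $1$ iff $u(\xi)=1$ for some $\xi\in I$. For $0\leq m_r\leq d_r$, $0\leq m_f\leq d_f$ and $u\in S$, $Sol_{BDC}^{m_r,d_r,m_f,d_f}(u)$ is the set of $x\in S$ such that for all $t\in\mathbb{R}$: $\bigcap_{\xi\in[t-d_r,t-d_r+m_r]}u(\xi)\leq x(t)\leq\bigcup_{\xi\in[t-d_f,t-d_f+m_f]}u(\xi)$. *)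

(* Defs.v *)
From HB Require Import structures.
From mathcomp Require Export all_boot all_order all_algebra.
From mathcomp Require Export all_classical all_reals all_analysis.

Set Implicit Arguments.
Unset Strict Implicit.
Unset Printing Implicit Defensive.

Import Order.TTheory GRing.Theory Num.Theory.

Local Open Scope classical_set_scope.
Local Open Scope ring_scope.

Definition constant_on (T U : Type) (A : set T) (f : T -> U) : Prop :=
  forall s t, A s -> A t -> f s = f t.

(* [increasing_seq] is strict: it states (t m <= t n) = (m <= n). *)
Definition signal (R : realType) : set (R -> bool) :=
  [set x | exists t : nat -> R,
    [/\ increasing_seq t,
        ~ has_ubound (range t),
        constant_on `]-oo, t 0%N[ x &
        forall k, constant_on `[t k, t k.+1[ x]].

Definition big_and (R : realType) (I : set R) (u : R -> bool) : bool :=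
  `[< forall xi, I xi -> u xi = true >].

Definition big_or (R : realType) (I : set R) (u : R -> bool) : bool :=
  `[< exists xi, I xi /\ u xi = true >].

Definition Sol_BDC (R : realType) (m_r d_r m_f d_f : R) (u : R -> bool) :
    set (R -> bool) :=
  [set x | signal x /\
    forall t : R,
      (big_and `[t - d_r, t - d_r + m_r] u <= x t)%O /\
      (x t <= big_or `[t - d_f, t - d_f + m_f] u)%O].

Definition deterministic (R : realType)
    (Sol : (R -> bool) -> set (R -> bool)) : Prop :=
  forall u, signal u -> exists! x, Sol u x.

(* Main.v *)
(** The two bounds defining [Sol_BDC] are the extreme candidate solutions.  For
    [u] the rising unit step they are the rising steps at [d_r] and at
    [d_f - m_f]; for [u] the falling step they are the falling steps at
    [d_r - m_r] and at [d_f].  The consistency hypotheses order them, so all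
    four are solutions, and determinism forces them to coincide in pairs. *)
Require Import Defs.
From mathcomp Require Import all_boot all_order all_algebra.
From mathcomp Require Import all_classical all_reals all_analysis.
From mathcomp Require Import lra.
Import Order.TTheory GRing.Theory Num.Theory.
Local Open Scope classical_set_scope.
Local Open Scope ring_scope.

(** Reading the order on booleans as implication turns bounds between step signals into implications
    between real inequalities, within reach of [lra]. *)
Lemma le_boolP (a b : bool) : reflect (a -> b) (a <= b)%O.
Proof. by case: a; case: b; constructor => // /(_ isT). Qed.

Lemma exists_unique_eq (T : Type) (P : T -> Prop) (x y : T) :
  (exists! z, P z) -> P x -> P y -> x = y.
Proof. by move=> [z [_ zP]] /zP <- /zP <-. Qed.

Section Signals.
Context {R : realType}.
Implicit Types (a b c d t : R) (u x : R -> bool).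

(** The parameter [f] treats both unit steps at once: [id] gives the rising one, [negb] the falling
    one. *)
Lemma signal_threshold (f : bool -> bool) a : signal (fun t => f (a <= t)).
Proof.
exists (fun n => a + n%:R); split.
- by apply/increasing_seqP => n; rewrite ltrD2l ltr_nat.
- move=> [M /= ubM].
  (* By the Archimedean property this index exceeds [M - a], so its term lies beyond [M]. *)
  have /ubM : range (fun n => a + n%:R) (a + (Num.bound `|M - a|)%:R).
    by exists (Num.bound `|M - a|).
  have := archi_boundP (normr_ge0 (M - a)).
  have := ler_norm (M - a).
  lra.
- move=> s t /=; rewrite !in_itv /= addr0 => sa ta.
  by rewrite !leNgt sa ta.
- move=> k s t /=; rewrite !in_itv /= => /andP[ks _] /andP[kt _].
  have k0 : 0 <= k%:R :> R by [].
  have -> : a <= s by lra.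
  by have -> : a <= t by lra.
Qed.

Lemma signal_shift d u : signal u -> signal (fun t => u (t - d)).
Proof.
move=> [t [incr_t unbdd_t u0 uk]]; exists (fun n => t n + d); split.
- by move=> m n; rewrite lerD2r incr_t.
- move=> [M ubM]; apply: unbdd_t; exists (M - d) => _ [n _ <-].
  by rewrite lerBrDr; apply: ubM; exists n.
- move=> r s /=; rewrite !in_itv /= => rt st.
  by apply: u0; rewrite /= in_itv /= ltrBlDr.
- move=> k r s /=; rewrite !in_itv /= => /andP[r1 r2] /andP[s1 s2].
  by apply: (uk k); rewrite /= in_itv /= lerBrDr ltrBlDr ?r1 ?r2 ?s1 ?s2.
Qed.

(** Evaluating the two steps at [b] yields [a <= b], and at [a] the reverse inequality. *)
Lemma threshold_inj (f : bool -> bool) a b : injective f ->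
  (fun t => f (a <= t)) = (fun t => f (b <= t)) -> a = b.
Proof.
move=> f_inj ab; apply/le_anti/andP; split.
- by have /f_inj := congr1 (fun g => g b) ab; rewrite lexx.
- by have /f_inj := congr1 (fun g => g a) ab; rewrite lexx.
Qed.

Lemma big_and_itv1 a u : big_and `[a, a] u = u a.
Proof.
rewrite /big_and set_itv1; apply/asboolP/idP => [|ua _ /= ->//].
by move=> /(_ a erefl).
Qed.

Lemma big_or_itv1 a u : big_or `[a, a] u = u a.
Proof.
rewrite /big_or set_itv1; apply/asboolP/idP => [[_ [/= ->]]//|ua].
by exists a.
Qed.

(** A rising step is monotone, so the left endpoint decides the intersection; likewise the right
    endpoint decides the union below. *)
Lemma big_and_rising c a b : a <= b ->
  big_and `[a, b] (fun t => c <= t) = (c <= a).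
Proof.
move=> ab; apply/asboolP/idP => [/(_ a) /=|ca t /=]; rewrite in_itv /=.
  by rewrite lexx ab; exact.
by move=> /andP[+ _]; exact: le_trans.
Qed.

Lemma big_or_rising c a b : a <= b ->
  big_or `[a, b] (fun t => c <= t) = (c <= b).
Proof.
move=> ab; apply/asboolP/idP => [[t [/=]]|cb]; last first.
  by exists b; rewrite /= in_itv /= lexx ab.
by rewrite in_itv /= => /andP[_ tb] ct; exact: le_trans tb.
Qed.

(** De Morgan duality carries the rising computations over to the falling step. *)
Lemma big_and_negb (A : set R) u :
  big_and A (fun t => ~~ u t) = ~~ big_or A u.
Proof.
apply/asboolP/negP => [uA /asboolP[t [At ut]]|uA t At].
  by have := uA t At; rewrite ut.
by apply/negP => ut; apply/uA/asboolP; exists t.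
Qed.

Lemma big_or_negb (A : set R) u :
  big_or A (fun t => ~~ u t) = ~~ big_and A u.
Proof.
rewrite -[LHS]negbK -big_and_negb; congr (~~ big_and A _).
by apply/funext => t; rewrite negbK.
Qed.

Section Solutions.
Variables m_r d_r m_f d_f : R.
Hypotheses (m_r0 : 0 <= m_r) (m_f0 : 0 <= m_f).

(** The lower bound on a solution is here the step at [d_r], the upper bound the step at
    [d_f - m_f]; any step switching in between fits. *)
Lemma Sol_BDC_rising c : d_f - m_f <= c <= d_r ->
  Sol_BDC m_r d_r m_f d_f (fun t => 0 <= t) (fun t => c <= t).
Proof.
move=> /andP[fc cr]; split; first exact: (signal_threshold id).
move=> t; rewrite big_and_rising ?lerDl// big_or_rising ?lerDl//.
by split; apply/le_boolP => ?; lra.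
Qed.

Lemma Sol_BDC_falling c : d_r - m_r <= c <= d_f ->
  Sol_BDC m_r d_r m_f d_f (fun t => ~~ (0 <= t)) (fun t => ~~ (c <= t)).
Proof.
move=> /andP[rc cf]; split; first exact: (signal_threshold negb).
move=> t; rewrite big_and_negb big_or_negb.
rewrite big_and_rising ?lerDl// big_or_rising ?lerDl// -!ltNge.
by split; apply/le_boolP => ?; lra.
Qed.

End Solutions.

(** Both windows shrink to the point [t - d], so the lower and upper bounds meet at [u (t - d)]. *)
Lemma Sol_BDC_pure_delay d u : signal u ->
  Sol_BDC 0 d 0 d u = [set (fun t => u (t - d))].
Proof.
move=> su; apply/seteqP; split => [x [_ xP]|_ ->].
  apply/funext => t; apply/le_anti/andP.
  by have := xP t; rewrite addr0 big_and_itv1 big_or_itv1 => -[-> ->].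
split; first exact: signal_shift.
by move=> t; rewrite addr0 big_and_itv1 big_or_itv1.
Qed.

End Signals.

Theorem theorem1p4 (R : realType) (m_r d_r m_f d_f : R)
    (hr : 0 <= m_r <= d_r) (hf : 0 <= m_f <= d_f)
    (hrf : d_r >= d_f - m_f) (hfr : d_f >= d_r - m_r) :
  [<-> deterministic (Sol_BDC m_r d_r m_f d_f);
       d_r = d_f - m_f /\ d_f = d_r - m_r;
       m_r = 0 /\ m_f = 0;
       exists d : R, 0 <= d /\
         forall u : R -> bool, signal u ->
           Sol_BDC m_r d_r m_f d_f u = [set (fun t : R => u (t - d))]].
Proof.
have [/andP[m_r0 m_rd] /andP[m_f0 m_fd]] := (hr, hf).
tfae.
- move=> det; split.
  + apply: (@threshold_inj _ id) => //.
    apply: (exists_unique_eq _ _ _ _ (det _ (signal_threshold id 0)));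
      by apply: Sol_BDC_rising => //; rewrite lexx hrf.
  + apply: (@threshold_inj _ negb); first exact: negb_inj.
    apply: (exists_unique_eq _ _ _ _ (det _ (signal_threshold negb 0)));
      by apply: Sol_BDC_falling => //; rewrite lexx hfr.
(* Adding the two equations gives [m_r + m_f = 0], a sum of nonnegative terms. *)
- by move=> [? ?]; split; lra.
- move=> [m_rE m_fE]; subst m_r m_f; exists d_r; split=> // u su.
  (* With zero memory the two consistency hypotheses become opposite inequalities between [d_r] and
     [d_f]. *)
  have -> : d_f = d_r by lra.
  exact: Sol_BDC_pure_delay.
- move=> [d [_ SolE]] u su; rewrite SolE//.
  by exists (fun t => u (t - d)); split => // x ->.
Qed.
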